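(* Let $A$ be a pseudocompact C$^*$-algebra and let $p\in A$ be a projection. Then the corner $pAp$ is a pseudocompact C$^*$-algebra.
   Context: A projection is an element $p$ with $p=p^*=p^2$. $M_n$ denotes the C$^*$-algebra of complex $n\times n$ matrices. Finite-dimensional C$^*$-algebras are, up to $*$-isomorphism, the finite direct sums of matrix algebras $M_n$. Continuous logic for C$^*$-algebras: atomic formulae are norms $\|P(x_1,\dots,x_k)\|$ of $*$-polynomials with complex coefficients (a constant $I$ for the identity may be used when the algebras are unital); formulae are built from these by applying continuous real-valued functions to finitely many formulae and by taking $\sup$ or $\inf$ of a variable over the closed unit ball. A sentence is a formula without free variables; $\varphi^A\in\mathbb{R}$ is its value in $A$. $A\equiv B$ (elementarily equivalent) if $\varphi^A=\varphi^B$ for every sentence $\varphi$. For an ultrafilter $\mathcal{U}$ on a set $I$, the ultraproduct $\prod_{\mathcal{U}}A_i$ is the C$^*$-algebra of bounded families $(a_i)_{i\in I}$ modulo those with $\lim_{\mathcal{U}}\|a_i\|=0$. A C$^*$-algebra is pseudocompact if it is elementarily equivalent to an ultraproduct of finite-dimensional C$^*$-algebras. *)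

(* Defs.v *)
From HB Require Import structures.
From mathcomp Require Import all_boot all_order all_algebra.
From mathcomp Require Import generic_quotient ring_quotient.
From mathcomp Require Import complex.
From mathcomp Require Import boolp classical_sets functions reals.
From mathcomp Require Import topology normedtype sequences.
From mathcomp Require Import lra.

Set Implicit Arguments.
Unset Strict Implicit.
Unset Printing Implicit Defensive.

Import Order.TTheory GRing.Theory Num.Theory.
Import numFieldNormedType.Exports.

Local Open Scope complex_scope.
Local Open Scope classical_set_scope.
Local Open Scope ring_scope.

HB.mixin Record CompleteNormedModule_isCstarAlg (R : realType) A
    & CompleteNormedModule R[i] A := {
  cmul : A -> A -> A;
  star : A -> A;
  cmulA : associative cmul;
  cmulDl : left_distributive cmul +%R;
  cmulDr : right_distributive cmul +%R;
  cscalerAl : forall (c : R[i]) (x y : A), c *: cmul x y = cmul (c *: x) y;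
  cscalerAr : forall (c : R[i]) (x y : A), c *: cmul x y = cmul x (c *: y);
  starK : involutive star;
  starD : {morph star : x y / x + y};
  starZ : forall (c : R[i]) (x : A), star (c *: x) = c^* *: star x;
  starM : forall x y : A, star (cmul x y) = cmul (star y) (star x);
  cnormM : forall x y : A, `|cmul x y| <= `|x| * `|y|;
  cstar_identity : forall x : A, `|cmul (star x) x| = `|x| ^+ 2
}.

#[short(type="cstarAlgType")]
HB.structure Definition CstarAlg (R : realType) :=
  {A of CompleteNormedModule R[i] A & CompleteNormedModule_isCstarAlg R A}.
Notation "x ** y" := (cmul x y) (at level 40, left associativity) : ring_scope.

(* The norm of a normed module over R[i] takes values in R[i]; rnorm is the same
   number seen in R. *)
Section RealNorm.
Context {R : realType} {V : normedModType R[i]}.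
Implicit Types x y : V.

Definition rnorm x : R := complex.Re `|x|.

Lemma rnormE x : (rnorm x)%:C = `|x|.
Proof. by rewrite /rnorm RRe_real// normr_real. Qed.

Lemma rnorm_ge0 x : 0 <= rnorm x.
Proof. by rewrite -lecR rnormE; exact: normr_ge0. Qed.

Lemma rnorm0 : rnorm (0 : V) = 0.
Proof. by rewrite /rnorm normr0. Qed.

Lemma rnorm_eq0 x : rnorm x = 0 -> x = 0.
Proof. by move=> h; apply/eqP; rewrite -normr_eq0 -rnormE h. Qed.

Lemma rnormD x y : rnorm (x + y) <= rnorm x + rnorm y.
Proof. by rewrite -lecR rmorphD/= !rnormE ler_normD. Qed.

Lemma rnormN x : rnorm (- x) = rnorm x.
Proof. by rewrite /rnorm normrN. Qed.

Lemma rnormZ (c : R[i]) x : rnorm (c *: x) = complex.Re `|c| * rnorm x.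
Proof.
have e : (complex.Re `|c|)%:C = `|c| by rewrite RRe_real// normr_real.
by apply: (@complexI R); rewrite rnormE normrZ -e -(rnormE x) -rmorphM.
Qed.

Lemma rnorm_ltE x (e : R) : (`|x| < e%:C) = (rnorm x < e).
Proof. by rewrite -rnormE ltcR. Qed.

Lemma rnorm_leE x (e : R) : (`|x| <= e%:C) = (rnorm x <= e).
Proof. by rewrite -rnormE lecR. Qed.

Lemma rnorm_distC x y : rnorm (x - y) = rnorm (y - x).
Proof. by rewrite -rnormN opprB. Qed.

Lemma rnorm_distD z x y : rnorm (x - y) <= rnorm (x - z) + rnorm (z - y).
Proof. by rewrite (le_trans _ (rnormD _ _))// addrA subrK. Qed.

Lemma half_small (e : R) : 0 < e ->
  exists N : nat, forall n, (N <= n)%N -> 2^-1 ^+ n < e.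
Proof.
move=> e0; have h : `|2^-1 : R| < 1.
  by rewrite ger0_norm ?invr_ge0// invf_lt1// ltr1n.
have /cvgrPdist_lt/(_ _ e0)[N _ hN] := cvg_expr h.
exists N => n /hN /=; rewrite sub0r normrN ger0_norm// exprn_ge0//.
by rewrite invr_ge0.
Qed.

(* A normed module is complete as soon as every sequence with geometrically
   small increments converges. *)
Lemma complete_of_seq :
  (forall u : nat -> V, (forall n, rnorm (u n.+1 - u n) <= 2^-1 ^+ n) ->
    exists l, forall e : R, 0 < e ->
      exists N : nat, forall n, (N <= n)%N -> rnorm (l - u n) < e) ->
  forall F : set_system V, ProperFilter F -> cauchy F -> cvg F.
Proof.
move=> hu F FF /cauchyP cF.
have dpos n : 0 < (2^-1 ^+ n / 4 : R)%:C.
  by rewrite (@ltcR _ 0) divr_gt0// exprn_gt0// invr_gt0.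
have /choice[u Fu] : forall n, exists x, F (ball x (2^-1 ^+ n / 4 : R)%:C).
  by move=> n; exact: cF.
have [|l hl] := hu u.
  move=> n; have [z []] := filter_ex (filterI (Fu n.+1) (Fu n)).
  rewrite -!ball_normE/= !rnorm_ltE => h1 h2.
  apply: (le_trans (rnorm_distD z _ _)); rewrite rnorm_distC in h2.
  apply: le_trans (lerD (ltW h1) (ltW h2)) _.
  have p0 : 0 <= (2^-1 : R) ^+ n by rewrite exprn_ge0// invr_ge0.
  by rewrite exprS; lra.
apply/cvg_ex; exists l; apply/cvgrPdist_lt => e e0.
have er : (complex.Re e)%:C = e by rewrite RRe_real// gtr0_real.
have e0' : 0 < complex.Re e by rewrite -ltcR er.
have e2 : 0 < complex.Re e / 2 by rewrite divr_gt0.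
have [N1 h1] := hl _ e2; have [N2 h2] := half_small e2.
pose n := maxn N1 N2; apply: filterS (Fu n) => y.
rewrite -ball_normE/= -er !rnorm_ltE => hy.
apply: le_lt_trans (rnorm_distD (u n) _ _) _.
have := h1 n (leq_maxl _ _); have := h2 n (leq_maxr _ _).
have p0 : 0 <= (2^-1 : R) ^+ n by rewrite exprn_ge0// invr_ge0.
by move: hy; lra.
Qed.

Lemma rnorm_increments (u : nat -> V) :
  (forall n, rnorm (u n.+1 - u n) <= 2^-1 ^+ n) ->
  forall n m, (n <= m)%N -> rnorm (u m - u n) <= 2 * 2^-1 ^+ n - 2 * 2^-1 ^+ m.
Proof.
move=> hu n m /subnKC <-; elim: (m - n)%N => [|k IH].
  by rewrite addn0 !subrr rnorm0.
rewrite addnS; apply: le_trans (rnorm_distD (u (n + k)%N) _ _) _.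
by have := hu (n + k)%N; move: IH; rewrite [_ ^+ (n + k).+1]exprS; lra.
Qed.

End RealNorm.

Lemma complete_seq {R : realType} {V : completeNormedModType R[i]}
    (u : nat -> V) : (forall n, rnorm (u n.+1 - u n) <= 2^-1 ^+ n) ->
  exists l, forall n, rnorm (l - u n) <= 2 * 2^-1 ^+ n.
Proof.
move=> /rnorm_increments hu.
have p0 n : 0 <= (2^-1 : R) ^+ n by rewrite exprn_ge0// invr_ge0.
have /cvg_ex[l ul] : cvg (u @ \oo).
  apply/cauchy_cvgP/cauchyP => e e0.
  have er : (complex.Re e)%:C = e by rewrite RRe_real// gtr0_real.
  have e0' : 0 < complex.Re e / 2 by rewrite divr_gt0// -ltcR er.
  have [N hN] := half_small e0'; exists (u N); exists N => // m /= Nm.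
  rewrite -ball_normE/= -er rnorm_ltE rnorm_distC.
  apply: le_lt_trans (hu _ _ Nm) _.
  by have := hN N (leqnn _); have := p0 m; lra.
exists l => n; rewrite leNgt; apply/negP => hlt.
have e0 : 0 < (rnorm (l - u n) - 2 * 2^-1 ^+ n)%:C by rewrite (@ltcR _ 0) subr_gt0.
have /cvgrPdist_lt/(_ _ e0)[N _ hN] := ul.
have := hN (maxn n N) (leq_maxr _ _); rewrite /= rnorm_ltE.
have := hu _ _ (leq_maxl n N); have := rnorm_distD (u (maxn n N)) l (u n).
by have := p0 (maxn n N); lra.
Qed.

Section CstarTheory.
Context {R : realType} {A : cstarAlgType R}.
Implicit Types x y z : A.

Lemma rnormM x y : rnorm (x ** y) <= rnorm x * rnorm y.
Proof. by rewrite -lecR rmorphM/= !rnormE cnormM. Qed.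

Lemma rnorm_star_mul x : rnorm (star x ** x) = rnorm x ^+ 2.
Proof. by apply: (@complexI R); rewrite rmorphXn/= !rnormE cstar_identity. Qed.

Lemma cmul0r x : 0 ** x = 0.
Proof. by rewrite -[X in X ** _](scale0r (0 : A)) -cscalerAl scale0r. Qed.

Lemma cmulr0 x : x ** 0 = 0.
Proof. by rewrite -[X in _ ** X](scale0r (0 : A)) -cscalerAr scale0r. Qed.

Lemma cmulNr x y : (- x) ** y = - (x ** y).
Proof. by rewrite -scaleN1r -cscalerAl scaleN1r. Qed.

Lemma cmulrN x y : x ** (- y) = - (x ** y).
Proof. by rewrite -[in LHS]scaleN1r -cscalerAr scaleN1r. Qed.

Lemma star0 : star (0 : A) = 0.
Proof. by apply: (addrI (star (0 : A))); rewrite -starD !addr0. Qed.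

Lemma starN x : star (- x) = - star x.
Proof. by apply/eqP; rewrite -addr_eq0 -starD addNr star0. Qed.

Lemma rnorm_star x : rnorm (star x) = rnorm x.
Proof.
suff le y : rnorm y <= rnorm (star y).
  by apply/eqP; rewrite eq_le le andbT -{2}[x]starK le.
have [->|y0] := eqVneq (rnorm y) 0; first exact: rnorm_ge0.
have yp : 0 < rnorm y by rewrite lt_neqAle eq_sym y0 rnorm_ge0.
by rewrite -(ler_pM2r yp) -expr2 -rnorm_star_mul rnormM.
Qed.

End CstarTheory.

Definition is_projection (R : realType) (A : cstarAlgType R) (p : A) : Prop :=
  p = star p /\ p = p ** p.

Section Corner.
Context {R : realType} {A : cstarAlgType R} {p : A} (hp : is_projection p).

Definition corner_pred (_ : is_projection p) : {pred A} :=
  fun x => x \in [set p ** a ** p | a in [set: A]].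

Record corner := Corner {
  corner_val :> A;
  corner_valP : corner_val \in corner_pred hp }.

HB.instance Definition _ := [isSub for corner_val].
HB.instance Definition _ := [Choice of corner by <:].

Lemma corner_predP x : reflect (p ** x ** p = x) (x \in corner_pred hp).
Proof.
have [_ pp] := hp; apply: (iffP idP) => [|h]; last first.
  by rewrite unfold_in; apply/mem_set; exists x.
rewrite unfold_in => /set_mem[a _ <-].
by rewrite !cmulA -pp -!cmulA -pp.
Qed.

Lemma corner_submod_closed : submod_closed (corner_pred hp).
Proof.
split=> [|c x y /corner_predP hx /corner_predP hy]; apply/corner_predP.
  by rewrite cmulr0 cmul0r.
by rewrite cmulDr cmulDl -cscalerAr -cscalerAl hx hy.
Qed.

HB.instance Definition _ :=
  GRing.isSubmodClosed.Build R[i] A (corner_pred hp) corner_submod_closed.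
HB.instance Definition _ := [SubChoice_isSubLmodule of corner by <:].

Lemma corner_normD (x y : corner) : `|val (x + y)| <= `|val x| + `|val y|.
Proof. by rewrite raddfD ler_normD. Qed.

Lemma corner_normZ (c : R[i]) (x : corner) :
  `|val (c *: x)| = `|c| * `|val x|.
Proof. by rewrite linearZ/= normrZ. Qed.

Lemma corner_normr0_eq0 (x : corner) : `|val x| = 0 -> x = 0.
Proof. by move/normr0_eq0 => h; apply: val_inj; rewrite raddf0. Qed.

HB.instance Definition _ := @Lmodule_isNormed.Build R[i] corner
  (fun x => `|val x|) corner_normD corner_normZ corner_normr0_eq0.

Lemma corner_normE (x : corner) : `|x| = `|val x|. Proof. by []. Qed.

Lemma corner_mulP (x y : corner) : val x ** val y \in corner_pred hp.
Proof.
have [_ pp] := hp; apply/corner_predP.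
have /corner_predP hx := corner_valP x.
have /corner_predP hy := corner_valP y.
by rewrite /= -hx -hy !cmulA -pp -!cmulA -pp.
Qed.

Lemma corner_starP (x : corner) : star (val x) \in corner_pred hp.
Proof.
have [ps _] := hp; apply/corner_predP.
have /corner_predP hx := corner_valP x.
by rewrite /= -[in RHS]hx !starM -ps !cmulA.
Qed.

Lemma corner_complete (F : set_system corner) :
  ProperFilter F -> cauchy F -> cvg F.
Proof.
apply: complete_of_seq => u hu.
have [|l hl] := @complete_seq _ A (fun n => val (u n)).
  by move=> n; rewrite -raddfB; exact: hu.
have [_ pp] := hp; have lP : p ** l ** p \in corner_pred hp.
  by apply/corner_predP; rewrite !cmulA -pp -!cmulA -pp.
exists (Corner lP) => e e0.
have c0 : 0 < 2 * (rnorm p ^+ 2 + 1) by rewrite mulr_gt0// ltr_wpDl// sqr_ge0.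
have [N hN] := half_small (divr_gt0 e0 c0).
exists N => n /hN; rewrite ltr_pdivlMr// => hn.
have -> : rnorm (Corner lP - u n) = rnorm (p ** (l - val (u n)) ** p).
  have /corner_predP hun := corner_valP (u n).
  rewrite cmulDr cmulDl cmulrN cmulNr hun.
  by rewrite /rnorm corner_normE raddfB.
apply: le_lt_trans hn; apply: (le_trans (rnormM _ _)).
apply: (@le_trans _ _ (rnorm p ^+ 2 * rnorm (l - val (u n)))).
  by rewrite expr2 mulrAC ler_wpM2r// ?rnorm_ge0// rnormM.
have q0 : 0 <= rnorm p ^+ 2 := sqr_ge0 _.
have p0 : 0 <= (2^-1 : R) ^+ n by rewrite exprn_ge0// invr_ge0.
by apply: le_trans (ler_wpM2l q0 (hl n)) _; nra.
Qed.

HB.instance Definition _ := Uniform_isComplete.Build corner corner_complete.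

Definition corner_mul (x y : corner) : corner := Corner (corner_mulP x y).
Definition corner_star (x : corner) : corner := Corner (corner_starP x).

Lemma corner_mulA : associative corner_mul.
Proof. by move=> x y z; apply: val_inj; apply: cmulA. Qed.

Lemma corner_mulDl : left_distributive corner_mul +%R.
Proof. by move=> x y z; apply: val_inj; apply: cmulDl. Qed.

Lemma corner_mulDr : right_distributive corner_mul +%R.
Proof. by move=> x y z; apply: val_inj; apply: cmulDr. Qed.

Lemma corner_scalerAl (c : R[i]) (x y : corner) :
  c *: corner_mul x y = corner_mul (c *: x) y.
Proof. by apply: val_inj; apply: cscalerAl. Qed.

Lemma corner_scalerAr (c : R[i]) (x y : corner) :
  c *: corner_mul x y = corner_mul x (c *: y).
Proof. by apply: val_inj; apply: cscalerAr. Qed.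

Lemma corner_starK : involutive corner_star.
Proof. by move=> x; apply: val_inj; apply: starK. Qed.

Lemma corner_starD : {morph corner_star : x y / x + y}.
Proof. by move=> x y; apply: val_inj; apply: starD. Qed.

Lemma corner_starZ (c : R[i]) (x : corner) :
  corner_star (c *: x) = c^* *: corner_star x.
Proof. by apply: val_inj; apply: starZ. Qed.

Lemma corner_starM (x y : corner) :
  corner_star (corner_mul x y) = corner_mul (corner_star y) (corner_star x).
Proof. by apply: val_inj; apply: starM. Qed.

Lemma corner_normM (x y : corner) : `|corner_mul x y| <= `|x| * `|y|.
Proof. exact: cnormM. Qed.

Lemma corner_cstar (x : corner) :
  `|corner_mul (corner_star x) x| = `|x| ^+ 2.
Proof. exact: cstar_identity. Qed.

HB.instance Definition _ := CompleteNormedModule_isCstarAlg.Build R corner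
  corner_mulA corner_mulDl corner_mulDr corner_scalerAl corner_scalerAr
  corner_starK corner_starD corner_starZ corner_starM corner_normM
  corner_cstar.

End Corner.

Section BoundedFamilies.
Context {R : realType} {I : Type} (F : I -> cstarAlgType R).

Record bfam := BFam {
  bfam_val :> forall i, F i;
  bfam_bnd : exists M : R, forall i, rnorm (bfam_val i) <= M }.

HB.instance Definition _ := gen_eqMixin bfam.
HB.instance Definition _ := gen_choiceMixin bfam.

Lemma bfamP (a b : bfam) : (forall i, a i = b i) -> a = b.
Proof.
case: a b => [a ha] [b hb] /= ab.
have {}ab : a = b by exact: functional_extensionality_dep.
by rewrite ab in ha *; congr BFam; exact: Prop_irrelevance.
Qed.

Lemma bfam0_bnd : exists M : R, forall i, rnorm (0 : F i) <= M.
Proof. by exists 0 => i; rewrite rnorm0. Qed.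

Lemma bfamD_bnd (a b : bfam) :
  exists M : R, forall i, rnorm (a i + b i) <= M.
Proof.
have [[M hM] [N hN]] := (bfam_bnd a, bfam_bnd b).
by exists (M + N) => i; apply: le_trans (rnormD _ _) (lerD _ _).
Qed.

Lemma bfamN_bnd (a : bfam) : exists M : R, forall i, rnorm (- a i) <= M.
Proof. by have [M hM] := bfam_bnd a; exists M => i; rewrite rnormN. Qed.

Lemma bfamZ_bnd (c : R[i]) (a : bfam) :
  exists M : R, forall i, rnorm (c *: a i) <= M.
Proof.
have [M hM] := bfam_bnd a; exists (complex.Re `|c| * M) => i.
by rewrite rnormZ ler_wpM2l// -lecR RRe_real ?normr_real//; exact: normr_ge0.
Qed.

Lemma bfamM_bnd (a b : bfam) :
  exists M : R, forall i, rnorm (a i ** b i) <= M.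
Proof.
have [[M hM] [N hN]] := (bfam_bnd a, bfam_bnd b).
exists (M * N) => i; apply: le_trans (rnormM _ _) _.
by apply: ler_pM; rewrite ?rnorm_ge0.
Qed.

Lemma bfam_star_bnd (a : bfam) : exists M : R, forall i, rnorm (star (a i)) <= M.
Proof. by have [M hM] := bfam_bnd a; exists M => i; rewrite rnorm_star. Qed.

Definition bfam0 := BFam bfam0_bnd.
Definition bfamD a b := BFam (bfamD_bnd a b).
Definition bfamN a := BFam (bfamN_bnd a).
Definition bfamZ c a := BFam (bfamZ_bnd c a).
Definition bfamM a b := BFam (bfamM_bnd a b).
Definition bfam_star a := BFam (bfam_star_bnd a).

Lemma bfamDA : associative bfamD.
Proof. by move=> a b c; apply: bfamP => i; exact: addrA. Qed.
Lemma bfamDC : commutative bfamD.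
Proof. by move=> a b; apply: bfamP => i; exact: addrC. Qed.
Lemma bfam0D : left_id bfam0 bfamD.
Proof. by move=> a; apply: bfamP => i; exact: add0r. Qed.
Lemma bfamND : left_inverse bfam0 bfamN bfamD.
Proof. by move=> a; apply: bfamP => i; exact: addNr. Qed.

HB.instance Definition _ :=
  GRing.isZmodule.Build bfam bfamDA bfamDC bfam0D bfamND.

Lemma bfamZA (c d : R[i]) (a : bfam) : bfamZ c (bfamZ d a) = bfamZ (c * d) a.
Proof. by apply: bfamP => i; exact: scalerA. Qed.
Lemma bfam1Z : left_id 1 bfamZ.
Proof. by move=> a; apply: bfamP => i; exact: scale1r. Qed.
Lemma bfamZDr : right_distributive bfamZ +%R.
Proof. by move=> c a b; apply: bfamP => i; exact: scalerDr. Qed.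
Lemma bfamZDl (a : bfam) : {morph bfamZ^~ a : c d / c + d}.
Proof. by move=> c d; apply: bfamP => i; exact: scalerDl. Qed.

HB.instance Definition _ :=
  GRing.Zmodule_isLmodule.Build R[i] bfam bfamZA bfam1Z bfamZDr bfamZDl.

End BoundedFamilies.

Section Ultraproduct.
Context {R : realType} {I : Type} {U : set_system I} (UU : UltraFilter U).
Variable F : I -> cstarAlgType R.
Implicit Types a b : bfam F.

(* the seminorm lim_U ||a_i|| on bounded families *)
Definition ulim a : R := lim ((fun i => rnorm (a i)) @ U).

Lemma ulim_cvg a : rnorm (a i) @[i --> U] --> ulim a.
Proof.
suff [l al] : exists l : R, rnorm (a i) @[i --> U] --> l.
  by apply/cvg_ex; exists l.
have [M hM] := bfam_bnd a.
pose f i := rnorm (a i).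
have UM : (f @ U) `[0, M]%classic.
  by apply: (@filterS _ U _ setT) filterT => i _ /=; rewrite in_itv/= rnorm_ge0 hM.
have [l [_ cl]] := @segment_compact R 0 M _ _ UM.
exists l; apply/cvgrPdist_lt => e e0.
have [//|UC] := in_ultra_setVsetC [set i | `|l - rnorm (a i)| < e] UU.
have UC' : (f @ U) [set x | ~ `|l - x| < e] by exact: UC.
have [x [/= xC]] := cl _ _ UC' (nbhsx_ballx l e e0).
by rewrite -ball_normE.
Qed.

Arguments ulim_cvg : clear implicits.

Lemma ulim_is_cvg a : cvg ((fun i => rnorm (a i)) @ U).
Proof. by apply/cvg_ex; exists (ulim a); exact: ulim_cvg. Qed.

Lemma ulim_uniq a (l : R) : rnorm (a i) @[i --> U] --> l -> ulim a = l.
Proof. by move=> al; exact: cvg_lim. Qed.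

Definition bfam_null (_ : UltraFilter U) : {pred bfam F} :=
  fun a => `[< rnorm (a i) @[i --> U] --> (0 : R) >].

Lemma bfam_nullP a : reflect (ulim a = 0) (a \in bfam_null UU).
Proof.
apply: (iffP (asboolP _)) => [|h]; first exact: ulim_uniq.
by have := ulim_cvg a; rewrite h.
Qed.

Lemma cvg_le (f g : I -> R) (l m : R) : (forall i, f i <= g i) ->
  f i @[i --> U] --> l -> g i @[i --> U] --> m -> l <= m.
Proof.
move=> fg fl gm; rewrite -subr_ge0.
have h : (g i - f i) @[i --> U] --> m - l by exact: cvgB.
apply: (@cvgr_to_ge _ U _ R _ (m - l) 0 h).
by apply: nearW => i /=; rewrite subr_ge0.
Qed.

Lemma ulim_ge0 a : 0 <= ulim a.
Proof.
by apply: (cvg_le _ (cvg_cst 0) (ulim_cvg a)) => i; exact: rnorm_ge0.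
Qed.

Lemma ulim_near_le a (e : R) :
  (\forall i \near U, rnorm (a i) <= e) -> ulim a <= e.
Proof. exact: (@cvgr_to_le _ U _ _ _ _ _ (ulim_cvg a)). Qed.

Lemma ulim_lt_near a (e : R) :
  ulim a < e -> \forall i \near U, rnorm (a i) < e.
Proof. exact: (@cvgr_lt _ _ U _ _ _ (ulim_cvg a)). Qed.

Lemma ulim0 : ulim 0 = 0.
Proof.
apply: ulim_uniq; rewrite [X in X @ U](_ : _ = fun=> 0); first exact: cvg_cst.
by apply/funext => i; rewrite rnorm0.
Qed.

Lemma ulimD a b : ulim (a + b) <= ulim a + ulim b.
Proof.
apply: (cvg_le _ (ulim_cvg (a + b)) (cvgD (ulim_cvg a) (ulim_cvg b))) => i; exact: rnormD.
Qed.

Lemma ulimN a : ulim (- a) = ulim a.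
Proof.
rewrite /ulim; congr (lim (_ @ U)); apply/funext => i; exact: rnormN.
Qed.

Lemma ulimZ (c : R[i]) a : ulim (c *: a) = complex.Re `|c| * ulim a.
Proof.
apply: ulim_uniq; rewrite (_ : (fun i => rnorm ((c *: a) i)) =
  fun i => complex.Re `|c| * rnorm (a i)).
  exact: cvgM (cvg_cst _) (ulim_cvg a).
by apply/funext => i; exact: rnormZ.
Qed.

Lemma ulimM a b : ulim (bfamM a b) <= ulim a * ulim b.
Proof.
apply: (cvg_le _ (ulim_cvg (bfamM a b)) (cvgM (ulim_cvg a) (ulim_cvg b))) => i; exact: rnormM.
Qed.

Lemma ulim_star a : ulim (bfam_star a) = ulim a.
Proof.
rewrite /ulim; congr (lim (_ @ U)); apply/funext => i; exact: rnorm_star.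
Qed.

Lemma ulim_cstar a : ulim (bfamM (bfam_star a) a) = ulim a ^+ 2.
Proof.
apply: ulim_uniq; rewrite (_ : (fun i => rnorm (bfamM (bfam_star a) a i)) =
  fun i => rnorm (a i) * rnorm (a i)).
  exact: cvgM (ulim_cvg a) (ulim_cvg a).
by apply/funext => i; exact: rnorm_star_mul.
Qed.

Lemma bfam_null_closed : zmod_closed (bfam_null UU).
Proof.
split=> [|a b /bfam_nullP ha /bfam_nullP hb]; apply/bfam_nullP.
  exact: ulim0.
apply/eqP; rewrite eq_le ulim_ge0 andbT.
by rewrite (le_trans (ulimD _ _))// ulimN ha hb addr0.
Qed.

HB.instance Definition _ :=
  GRing.isZmodClosed.Build (bfam F) (bfam_null UU) bfam_null_closed.

Definition ultraproduct : Type := Quotient.quot (bfam_null UU).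

HB.instance Definition _ := GRing.Zmodule.on ultraproduct.
HB.instance Definition _ := EqQuotient.on ultraproduct.

Definition uclass a : ultraproduct := (\pi_ultraproduct a)%qT.
Definition urepr (x : ultraproduct) : bfam F := repr x.

Lemma ureprK x : uclass (urepr x) = x. Proof. exact: reprK. Qed.

Lemma uclassP a b : uclass a = uclass b <-> ulim (a - b) = 0.
Proof.
rewrite (rwP (bfam_nullP _)) Quotient.idealrBE; split => [h|/eqP//].
by apply/eqP.
Qed.

Lemma uclassD a b : uclass (a + b) = uclass a + uclass b.
Proof. exact: Quotient.pi_add. Qed.

Lemma uclass0 : uclass 0 = 0.
Proof. by apply: (addrI (uclass 0)); rewrite -uclassD !addr0. Qed.

Lemma uclassN a : uclass (- a) = - uclass a.
Proof. by apply/eqP; rewrite -addr_eq0 -uclassD addNr uclass0. Qed.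

Lemma urepr_near a : ulim (urepr (uclass a) - a) = 0.
Proof. by apply/uclassP; rewrite ureprK. Qed.

Lemma ulim_eq a b : ulim (a - b) = 0 -> ulim a = ulim b.
Proof.
move=> ab; apply/eqP; rewrite eq_le; apply/andP; split.
  by rewrite -[a](subrK b) (le_trans (ulimD _ _))// ab add0r.
rewrite -[b](subrK a) (le_trans (ulimD _ _))//.
by rewrite -opprB ulimN ab add0r.
Qed.

Definition uscale (c : R[i]) (x : ultraproduct) := uclass (c *: urepr x).
Definition umul (x y : ultraproduct) := uclass (bfamM (urepr x) (urepr y)).
Definition ustar (x : ultraproduct) := uclass (bfam_star (urepr x)).
Definition unorm (x : ultraproduct) : R[i] := (ulim (urepr x))%:C.

Lemma uscaleE c a : uscale c (uclass a) = uclass (c *: a).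
Proof. by apply/uclassP; rewrite -scalerBr ulimZ urepr_near mulr0. Qed.

Lemma umulE a b : umul (uclass a) (uclass b) = uclass (bfamM a b).
Proof.
apply/uclassP; set a' := urepr _; set b' := urepr _.
have -> : bfamM a' b' - bfamM a b = bfamM (a' - a) b' + bfamM a (b' - b).
  apply: bfamP => i /=; rewrite cmulDl cmulDr cmulNr cmulrN addrA subrK//.
apply/eqP; rewrite eq_le ulim_ge0 andbT (le_trans (ulimD _ _))//.
rewrite (le_trans (lerD (ulimM _ _) (ulimM _ _)))//.
by rewrite !urepr_near mul0r mulr0 addr0.
Qed.

Lemma ustarE a : ustar (uclass a) = uclass (bfam_star a).
Proof.
apply/uclassP; rewrite -[RHS](urepr_near a) -[RHS]ulim_star; congr ulim.
by apply: bfamP => i /=; rewrite starD starN.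
Qed.

Lemma unormE a : unorm (uclass a) = (ulim a)%:C.
Proof. by congr (_%:C); apply/ulim_eq/urepr_near. Qed.

Lemma uclass_surj x : exists a, uclass a = x.
Proof. by exists (urepr x); exact: ureprK. Qed.

Lemma uscaleA c d x : uscale c (uscale d x) = uscale (c * d) x.
Proof. by have [a <-] := uclass_surj x; rewrite !uscaleE scalerA. Qed.

Lemma uscale1 : left_id 1 uscale.
Proof. by move=> x; have [a <-] := uclass_surj x; rewrite uscaleE scale1r. Qed.

Lemma uscaleDr : right_distributive uscale +%R.
Proof.
move=> c x y; have [a <-] := uclass_surj x; have [b <-] := uclass_surj y.
by rewrite -uclassD !uscaleE scalerDr uclassD.
Qed.

Lemma uscaleDl x : {morph uscale^~ x : c d / c + d}.
Proof.
move=> c d; have [a <-] := uclass_surj x.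
by rewrite !uscaleE scalerDl uclassD.
Qed.

HB.instance Definition _ := GRing.Zmodule_isLmodule.Build R[i] ultraproduct
  uscaleA uscale1 uscaleDr uscaleDl.

Lemma uclassZ c a : uclass (c *: a) = c *: uclass a.
Proof. by rewrite -uscaleE. Qed.

Lemma unormD x y : unorm (x + y) <= unorm x + unorm y.
Proof.
have [a <-] := uclass_surj x; have [b <-] := uclass_surj y.
by rewrite -uclassD !unormE -rmorphD lecR ulimD.
Qed.

Lemma unormZ (c : R[i]) x : unorm (c *: x) = `|c| * unorm x.
Proof.
have [a <-] := uclass_surj x; rewrite -uclassZ !unormE ulimZ rmorphM.
by congr (_ * _); apply: RRe_real; exact: normr_real.
Qed.

Lemma unorm_eq0 x : unorm x = 0 -> x = 0.
Proof.
have [a <-] := uclass_surj x; rewrite unormE => /(@complexI R _ 0) a0.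
by rewrite -uclass0; apply/uclassP; rewrite subr0.
Qed.

HB.instance Definition _ := Lmodule_isNormed.Build R[i] ultraproduct
  unormD unormZ unorm_eq0.

Lemma rnorm_uclass a : rnorm (uclass a) = ulim a.
Proof.
have -> : rnorm (uclass a) = complex.Re (unorm (uclass a)) by [].
by rewrite unormE.
Qed.

Lemma ultraproduct_complete (X : set_system ultraproduct) :
  ProperFilter X -> cauchy X -> cvg X.
Proof.
apply: complete_of_seq => u hu.
have p0 n : 0 < (2^-1 : R) ^+ n by rewrite exprn_gt0// invr_gt0.
pose z n := urepr (u n.+1).
have znear n : \forall i \near U, rnorm (z n.+1 i - z n i) <= 2^-1 ^+ n.
  have /ulim_lt_near : ulim (z n.+1 - z n) < 2^-1 ^+ n.
    rewrite -rnorm_uclass uclassD uclassN !ureprK.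
    by apply: le_lt_trans (hu n.+1) _; rewrite exprS; have := p0 n; lra.
  by apply: (@filterS _ U) => i /ltW.
(* correct z into a family y with small increments at every index *)
pose d n i := if rnorm (z n.+1 i - z n i) <= 2^-1 ^+ n
              then z n.+1 i - z n i else 0.
pose y := fix y n i := if n is m.+1 then y m i + d m i else z 0 i.
have hd n i : rnorm (y n.+1 i - y n i) <= 2^-1 ^+ n.
  rewrite /= addrAC subrr add0r /d; case: ifP => // _.
  by rewrite rnorm0 ltW.
have ynear n : \forall i \near U, y n i = z n i.
  elim: n => [|n IH]; first exact: (@filterS _ U _ setT) filterT.
  apply: (@filterS2 _ U _ _ _ _ _ (znear n) IH) => i hz /= ->.
  by rewrite /d hz addrC subrK.
have hl i := cid (complete_seq (hd^~ i)).
pose l i := projT1 (hl i).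
have ly i n : rnorm (l i - y n i) <= 2 * 2^-1 ^+ n := projT2 (hl i) n.
have lb : exists M : R, forall i, rnorm (l i) <= M.
  have [M hM] := bfam_bnd (z 0); exists (2 + M) => i.
  rewrite -[l i](subrK (y 0 i)); apply: le_trans (rnormD _ _) (lerD _ (hM i)).
  by apply: le_trans (ly i 0) _; rewrite expr0 mulr1.
exists (uclass (BFam lb)) => e e0.
have e2 : 0 < e / 2 by rewrite divr_gt0.
have [N hN] := half_small e2; exists N.+1 => -[//|n] Nn.
rewrite -(ureprK (u n.+1)) -uclassN -uclassD rnorm_uclass.
apply: (@le_lt_trans _ _ (2 * 2^-1 ^+ n)); last by have := hN n Nn; lra.
apply: ulim_near_le; apply: (@filterS _ U _ _ _ _ (ynear n)) => i /= yz.
by have := ly i n; rewrite yz.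
Qed.

HB.instance Definition _ :=
  Uniform_isComplete.Build ultraproduct ultraproduct_complete.

Lemma umulA : associative umul.
Proof.
move=> x y t; have [a <-] := uclass_surj x; have [b <-] := uclass_surj y.
have [c <-] := uclass_surj t; rewrite !umulE; congr uclass.
by apply: bfamP => i; exact: cmulA.
Qed.

Lemma umulDl : left_distributive umul +%R.
Proof.
move=> x y t; have [a <-] := uclass_surj x; have [b <-] := uclass_surj y.
have [c <-] := uclass_surj t; rewrite -uclassD !umulE -uclassD; congr uclass.
by apply: bfamP => i; exact: cmulDl.
Qed.

Lemma umulDr : right_distributive umul +%R.
Proof.
move=> x y t; have [a <-] := uclass_surj x; have [b <-] := uclass_surj y.
have [c <-] := uclass_surj t; rewrite -uclassD !umulE -uclassD; congr uclass.
by apply: bfamP => i; exact: cmulDr.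
Qed.

Lemma umulZl (c : R[i]) x y : c *: umul x y = umul (c *: x) y.
Proof.
have [a <-] := uclass_surj x; have [b <-] := uclass_surj y.
rewrite umulE -!uclassZ umulE; congr uclass.
by apply: bfamP => i; exact: cscalerAl.
Qed.

Lemma umulZr (c : R[i]) x y : c *: umul x y = umul x (c *: y).
Proof.
have [a <-] := uclass_surj x; have [b <-] := uclass_surj y.
rewrite umulE -!uclassZ umulE; congr uclass.
by apply: bfamP => i; exact: cscalerAr.
Qed.

Lemma ustarK : involutive ustar.
Proof.
move=> x; have [a <-] := uclass_surj x; rewrite !ustarE; congr uclass.
by apply: bfamP => i; exact: starK.
Qed.

Lemma ustarD : {morph ustar : x y / x + y}.
Proof.
move=> x y; have [a <-] := uclass_surj x; have [b <-] := uclass_surj y.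
rewrite -uclassD !ustarE -uclassD; congr uclass.
by apply: bfamP => i; exact: starD.
Qed.

Lemma ustarZ (c : R[i]) x : ustar (c *: x) = c^* *: ustar x.
Proof.
have [a <-] := uclass_surj x; rewrite ustarE -!uclassZ ustarE; congr uclass.
by apply: bfamP => i; exact: starZ.
Qed.

Lemma ustarM x y : ustar (umul x y) = umul (ustar y) (ustar x).
Proof.
have [a <-] := uclass_surj x; have [b <-] := uclass_surj y.
rewrite umulE !ustarE umulE; congr uclass.
by apply: bfamP => i; exact: starM.
Qed.

Lemma unormM x y : `|umul x y| <= `|x| * `|y|.
Proof.
have [a <-] := uclass_surj x; have [b <-] := uclass_surj y.
by rewrite umulE -!rnormE !rnorm_uclass -rmorphM lecR ulimM.
Qed.

Lemma ucstar x : `|umul (ustar x) x| = `|x| ^+ 2.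
Proof.
have [a <-] := uclass_surj x.
by rewrite ustarE umulE -!rnormE !rnorm_uclass -rmorphXn ulim_cstar.
Qed.

HB.instance Definition _ := CompleteNormedModule_isCstarAlg.Build R ultraproduct
  umulA umulDl umulDr umulZl umulZr ustarK ustarD ustarZ ustarM unormM ucstar.

End Ultraproduct.

(* term R k: *-polynomials over R[i] in the variables x_0, ..., x_(k-1), possibly
   with the constant I (tunit); tzero is needed for the zero polynomial when
   k = 0 and I is not used. *)
Inductive term (R : realType) (k : nat) : Type :=
| tvar of 'I_k
| tzero
| tunit
| tadd of term R k & term R k
| tscale of R[i] & term R k
| tmul of term R k & term R k
| tstar of term R k.

Arguments tzero {R k}.
Arguments tunit {R k}.

(* formula R k: formulae with free variables among x_0, ..., x_(k-1). The
   quantifiers fsup and finf bind the variable x_0 of their body, whose remaining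
   variables are shifted by one. *)
Inductive formula (R : realType) : nat -> Type :=
| fnorm (k : nat) of term R k : formula R k
| fapp (k n : nat) (f : 'rV[R]_n -> R) of continuous f
    & ('I_n -> formula R k) : formula R k
| fsup (k : nat) of formula R k.+1 : formula R k
| finf (k : nat) of formula R k.+1 : formula R k.

Definition sentence (R : realType) := formula R 0.

Fixpoint term_unit_free {R : realType} {k} (t : term R k) : bool :=
  match t with
  | tvar _ | tzero => true
  | tunit => false
  | tadd t1 t2 | tmul t1 t2 => term_unit_free t1 && term_unit_free t2
  | tscale _ t1 | tstar t1 => term_unit_free t1
  end.

Fixpoint unit_free {R : realType} {k} (phi : formula R k) : bool :=
  match phi with
  | fnorm _ t => term_unit_free t
  | fapp _ n _ _ args => [forall j : 'I_n, unit_free (args j)]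
  | fsup _ psi | finf _ psi => unit_free psi
  end.

Section Semantics.
Context {R : realType} (A : cstarAlgType R).

Definition is_unit (e : A) : Prop := forall x : A, e ** x = x /\ x ** e = x.

Definition unital : Prop := exists e : A, is_unit e.

(* the unit of A if there is one, and the irrelevant value 0 otherwise *)
Definition cunit : A := xget 0 [set e | is_unit e].

Fixpoint eval_term {k} (t : term R k) (v : k.-tuple A) : A :=
  match t with
  | tvar j => tnth v j
  | tzero => 0
  | tunit => cunit
  | tadd t1 t2 => eval_term t1 v + eval_term t2 v
  | tscale c t1 => c *: eval_term t1 v
  | tmul t1 t2 => eval_term t1 v ** eval_term t2 v
  | tstar t1 => star (eval_term t1 v)
  end.

Definition unit_ball : set A := [set a | `|a| <= 1].

Fixpoint eval_formula {k} (phi : formula R k) : k.-tuple A -> R :=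
  match phi with
  | fnorm _ t => fun v => rnorm (eval_term t v)
  | fapp _ _ f _ args => fun v => f (\row_j eval_formula (args j) v)
  | fsup _ psi => fun v => sup [set eval_formula psi [tuple of a :: v] | a in unit_ball]
  | finf _ psi => fun v => inf [set eval_formula psi [tuple of a :: v] | a in unit_ball]
  end.

Definition sentence_value (phi : sentence R) : R := eval_formula phi [tuple].

Definition finite_dimensional : Prop :=
  exists (n : nat) (b : 'I_n -> A),
    forall x : A, exists c : 'I_n -> R[i], x = \sum_(j < n) c j *: b j.

End Semantics.

(* Sentences using the constant I are only compared between unital algebras. *)
Definition elementarily_equivalent (R : realType) (A B : cstarAlgType R) : Prop :=
  forall phi : sentence R, unit_free phi \/ (unital A /\ unital B) ->
    sentence_value A phi = sentence_value B phi.

Definition pseudocompact (R : realType) (A : cstarAlgType R) : Prop :=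
  exists (I : Type) (U : set_system I) (UU : UltraFilter U)
         (F : I -> cstarAlgType R),
    (forall i, finite_dimensional (F i)) /\
    elementarily_equivalent A (ultraproduct UU F).

(* Main.v *)
Require Import Defs.
From mathcomp Require Import all_boot all_order all_algebra.
From mathcomp Require Import complex.
From mathcomp Require Import boolp classical_sets reals topology normedtype.
From mathcomp Require Import lra.

(** The corner [pAp] is definable in the pair [(A, p)], and projections of an
    ultraproduct lift to families of projections; together these move corners
    across the elementary equivalence of [A] with an ultraproduct of
    finite-dimensional algebras.

    Definability: replacing every variable [v] of a formula [phi] by [x v x] and
    the constant [I] by [x] gives a formula [relativize phi] with one more free
    variable [x], not mentioning [I], whose value at a projection [q] is the value
    of [phi] in the corner of [q] ([eval_relativize]). The quantifiers need no
    change because [a |-> q a q] maps the unit ball of the algebra onto that of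
    the corner. So the theory of [pAp] is part of the type of [p] in [A].

    Transfer of the type: let [A] be elementarily equivalent to an ultraproduct of
    the [F i]. For finitely many formulae [psi] and an error [e], the sentence
    [inf_x dist (psi x) (psi p)] has value 0 in [A], hence in the ultraproduct,
    so by the theorem of Los ([los]) some [F i] contains [x] with all
    [psi x] within [e] of [psi p]. Taking an ultraproduct of these [F i] over the
    directed set of finite sets of formulae and errors produces an element [P]
    with the same values as [p] on all formulae without [I]
    ([type_realization]); in particular [P] is a projection.

    Lifting: a self-adjoint representative of [P] is an almost projection at
    almost all indices, and a Newton iteration deforms it to a projection nearby
    ([projection_near], [projection_lift]). Hence [P] is the class of projections
    [q j], and by [los], used once for the relativized formulae at [q] and once for
    the algebras [q j F q j], the theory of [pAp] is that of the ultraproduct of the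
    finite-dimensional corners of the [q j]. *)

Set Implicit Arguments.
Unset Strict Implicit.
Unset Printing Implicit Defensive.

Import Order.TTheory GRing.Theory Num.Theory.
Import numFieldNormedType.Exports.

Local Open Scope complex_scope.
Local Open Scope classical_set_scope.
Local Open Scope ring_scope.

(** * Corners as relativized formulae *)

Lemma unit_ballE (R : realType) (A : cstarAlgType R) (a : A) :
  unit_ball a = (rnorm a <= 1).
Proof. by rewrite /unit_ball/= -rnorm_leE. Qed.

Lemma rnorm_projection (R : realType) (A : cstarAlgType R) (q : A) :
  is_projection q -> rnorm q <= 1.
Proof.
case=> qs qq; have := rnorm_star_mul q; rewrite -qs -qq.
by have := rnorm_ge0 q; nra.
Qed.

Lemma compress_subproof (R : realType) (A : cstarAlgType R) (q : A)
  (hq : is_projection q) (a : A) : q ** a ** q \in corner_pred hq.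
Proof.
have [_ qq] := hq.
by apply/corner_predP; rewrite !cmulA -qq -!cmulA -qq.
Qed.

Definition compress (R : realType) (A : cstarAlgType R) (q : A)
  (hq : is_projection q) (a : A) : corner hq := Corner (compress_subproof hq a).

Lemma compressK (R : realType) (A : cstarAlgType R) (q : A)
  (hq : is_projection q) (b : corner hq) : compress hq (val b) = b.
Proof. by apply: val_inj; apply/corner_predP/valP. Qed.

Lemma rnorm_compress (R : realType) (A : cstarAlgType R) (q : A)
  (hq : is_projection q) (a : A) : rnorm (compress hq a) <= rnorm a.
Proof.
have -> : rnorm (compress hq a) = rnorm (q ** a ** q) by [].
apply: le_trans (rnormM _ _) _; apply: le_trans (_ : rnorm (q ** a) * 1 <= _).
  by rewrite ler_wpM2l ?rnorm_ge0// rnorm_projection.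
rewrite mulr1; apply: le_trans (rnormM _ _) _.
by rewrite ler_piMl ?rnorm_ge0// rnorm_projection.
Qed.

Lemma cunitP (R : realType) (A : cstarAlgType R) (e : A) :
  is_unit e -> cunit A = e.
Proof.
move=> he; rewrite /cunit; case: xgetP => [u _ hu|/(_ e)//].
by rewrite -(he u).1 (hu e).2.
Qed.

Lemma corner_is_unit (R : realType) (A : cstarAlgType R) (q : A)
  (hq : is_projection q) : is_unit (compress hq q).
Proof.
have [_ qq] := hq; move=> b; have /corner_predP hb := corner_valP b.
by split; apply: val_inj; rewrite /= -qq -qq -hb ?cmulA -?qq// -!cmulA -qq.
Qed.

(** The new variable is the last one, so that the variable bound by a quantifier
    stays in front. *)
Fixpoint relativize_term {R : realType} {k} (t : term R k) : term R k.+1 :=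
  let x := tvar R ord_max in
  match t with
  | tvar j => tmul (tmul x (tvar R (widen_ord (leqnSn k) j))) x
  | tzero => tzero
  | tunit => x
  | tadd t1 t2 => tadd (relativize_term t1) (relativize_term t2)
  | tscale c t1 => tscale c (relativize_term t1)
  | tmul t1 t2 => tmul (relativize_term t1) (relativize_term t2)
  | tstar t1 => tstar (relativize_term t1)
  end.

Fixpoint relativize {R : realType} {k} (phi : formula R k) : formula R k.+1 :=
  match phi with
  | fnorm _ t => fnorm (relativize_term t)
  | fapp _ n f cf args => fapp cf (fun j => relativize (args j))
  | fsup _ psi => fsup (relativize psi)
  | finf _ psi => finf (relativize psi)
  end.

Lemma relativize_unit_free (R : realType) k (phi : formula R k) : unit_free (relativize phi).
Proof.
elim: phi => // [{}k t|{}k n f cf args IH] /=; last exact/forallP.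
by elim: t => //= t1 -> t2 ->.
Qed.

Lemma tnth_rcons_max (T : Type) k (v : k.-tuple T) (a : T) :
  tnth [tuple of rcons v a] ord_max = a.
Proof. by rewrite (tnth_nth a)/= nth_rcons size_tuple ltnn eqxx. Qed.

Lemma tnth_rcons_widen (T : Type) k (v : k.-tuple T) (a : T) (j : 'I_k) :
  tnth [tuple of rcons v a] (widen_ord (leqnSn k) j) = tnth v j.
Proof. by rewrite !(tnth_nth a)/= nth_rcons size_tuple ltn_ord. Qed.

Lemma eval_relativize_term (R : realType) (A : cstarAlgType R) (q : A)
  (hq : is_projection q) k (t : term R k) (v : k.-tuple A) :
  val (eval_term t [tuple of map (compress hq) v]) =
  eval_term (relativize_term t) [tuple of rcons v q].
Proof.
elim: t => [j||| t1 IH1 t2 IH2 | c t1 IH1 | t1 IH1 t2 IH2 | t1 IH1] //=.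
- by rewrite tnth_map tnth_rcons_max tnth_rcons_widen.
- rewrite (cunitP (@corner_is_unit _ _ _ hq)) tnth_rcons_max /=.
  by have [_ qq] := hq; rewrite -!qq.
- by rewrite -IH1 -IH2.
- by rewrite -IH1.
- by rewrite -IH1 -IH2.
- by rewrite -IH1.
Qed.

(** The quantifiers agree because compression maps the unit ball of [A] onto the
    unit ball of the corner: it is contractive, and it fixes the corner. *)
Lemma eval_relativize (R : realType) (A : cstarAlgType R) (q : A)
  (hq : is_projection q) k (phi : formula R k) (v : k.-tuple A) :
  eval_formula phi [tuple of map (compress hq) v] =
  eval_formula (relativize phi) [tuple of rcons v q].
Proof.
have quantifier_range m (psi : formula R m.+1) (w : m.-tuple A) :
    (forall w' : m.+1.-tuple A, eval_formula psi [tuple of map (compress hq) w'] =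
      eval_formula (relativize psi) [tuple of rcons w' q]) ->
    [set eval_formula psi [tuple of a :: [tuple of map (compress hq) w]]
      | a in @unit_ball R (corner hq)] =
    [set eval_formula (relativize psi) [tuple of a :: [tuple of rcons w q]]
      | a in @unit_ball R A].
  move=> IH.
  have IHc a :
      eval_formula psi
        [tuple of compress hq a :: [tuple of map (compress hq) w]] =
      eval_formula (relativize psi) [tuple of a :: [tuple of rcons w q]].
    have := IH [tuple of a :: w].
    rewrite (_ : [tuple of map _ _] =
      [tuple of compress hq a :: [tuple of map (compress hq) w]]);
      last exact: val_inj.
    by move=> ->; congr eval_formula; apply: val_inj.
  apply/seteqP; split => _ [a ha <-].
    by exists (val a); rewrite // -IHc compressK.
  exists (compress hq a); rewrite ?IHc// unit_ballE.
  by apply: le_trans (rnorm_compress _ _) _; rewrite -unit_ballE.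
elim: phi v => [{}k t|{}k n f cf args IH|{}k psi IH|{}k psi IH] v /=.
- by rewrite -eval_relativize_term.
- by congr f; apply/rowP => j; rewrite !mxE IH.
- by rewrite quantifier_range.
- by rewrite quantifier_range.
Qed.

(** * Bounds on formulae and suprema over unit balls of ultraproducts *)

Lemma rnorm_cunit (R : realType) (A : cstarAlgType R) : rnorm (cunit A) <= 1.
Proof.
rewrite /cunit; case: xgetP => [e _ he|_]; last by rewrite rnorm0.
have := rnorm_star_mul e; rewrite (he (star e)).2 rnorm_star.
by have := rnorm_ge0 e; nra.
Qed.

Lemma eval_term_bounded (R : realType) k (t : term R k) (M : R) :
  exists C : R, forall (A : cstarAlgType R) (v : k.-tuple A),
    (forall j, rnorm (tnth v j) <= M) -> rnorm (eval_term t v) <= C.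
Proof.
elim: t => [j|||t1 [C1 h1] t2 [C2 h2]|c t1 [C1 h1]|t1 [C1 h1] t2 [C2 h2]
  |t1 [C1 h1]].
- by exists M => A v; apply.
- by exists 0 => A v _; rewrite rnorm0.
- by exists 1 => A v _; exact: rnorm_cunit.
- exists (C1 + C2) => A v hv; apply: le_trans (rnormD _ _) _.
  by apply: lerD; [exact: h1|exact: h2].
- exists (complex.Re `|c| * C1) => A v hv; rewrite /= rnormZ.
  apply: ler_wpM2l (h1 _ _ hv).
  by rewrite -lecR RRe_real ?normr_real//; exact: normr_ge0.
- exists (C1 * C2) => A v hv; apply: le_trans (rnormM _ _) _.
  by apply: ler_pM; rewrite ?rnorm_ge0//; [exact: h1|exact: h2].
- by exists C1 => A v hv; rewrite /= rnorm_star; exact: h1.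
Qed.

Lemma sup_image_bounded (R : realType) (T : Type) (B : set T) (g : T -> R)
  (C : R) : B !=set0 -> (forall a, B a -> `|g a| <= C) ->
  `|sup [set g a | a in B]| <= C.
Proof.
move=> [a0 Ba0] hg; rewrite ler_norml; apply/andP; split.
  apply: (@le_trans _ _ (g a0)).
    by have := hg _ Ba0; rewrite ler_norml => /andP[].
  apply: ub_le_sup; last by exists a0.
  by exists C => _ [a Ba <-]; exact: le_trans (ler_norm _) (hg _ Ba).
apply: ge_sup; first by exists (g a0), a0.
by move=> _ [a Ba <-]; exact: le_trans (ler_norm _) (hg _ Ba).
Qed.

Lemma inf_imageE (R : realType) (T : Type) (B : set T) (g : T -> R) :
  inf [set g a | a in B] = - sup [set - g a | a in B].
Proof.
rewrite /inf; congr (- sup _); apply/seteqP.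
split => [_ [_ [a Ba <-] <-]|_ [a Ba <-]].
  by exists a.
by exists (g a) => //; exists a.
Qed.

Lemma unit_ball0 (R : realType) (A : cstarAlgType R) : (@unit_ball R A) 0.
Proof. by rewrite unit_ballE rnorm0. Qed.

Lemma rnorm_tnth_cons (R : realType) (A : cstarAlgType R) k (a : A)
    (v : k.-tuple A) (M : R) :
  unit_ball a -> (forall j, rnorm (tnth v j) <= M) ->
  forall j, rnorm (tnth [tuple of a :: v] j) <= Num.max 1 M.
Proof.
rewrite unit_ballE => ha hv j; rewrite le_max.
by case: (unliftP ord0 j) => [i ->|->]; rewrite ?tnthS ?tnth0 ?hv ?ha ?orbT.
Qed.

(** The bound must not depend on the algebra: [sup] has a junk value on unbounded
    sets, and the theorem of Los needs it to be an honest supremum uniformly along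
    a family of algebras. *)
Lemma eval_formula_bounded (R : realType) k (phi : formula R k) (M : R) :
  exists C : R, forall (A : cstarAlgType R) (v : k.-tuple A),
    (forall j, rnorm (tnth v j) <= M) -> `|eval_formula phi v| <= C.
Proof.
elim: phi M => [{}k t|{}k n f cf args IH|{}k psi IH|{}k psi IH] M.
- have [C hC] := eval_term_bounded t M; exists C => A v /hC /=.
  by rewrite ger0_norm ?rnorm_ge0.
- have /choice[C hC] := fun j => IH j M.
  have cK := @rV_compact R n (fun i => `[- C i, C i]%classic)
    (fun i => @segment_compact R _ _).
  have /compact_bounded := continuous_compact (continuous_subspaceT cf) cK.
  move=> [N [_ hN]]; exists (N + 1) => A v hv; apply: hN; first by rewrite ltrDl.
  exists (\row_j eval_formula (args j) v) => // i.
  by rewrite mxE/= in_itv/= -ler_norml; exact: hC.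
- have [C hC] := IH (Num.max 1 M); exists C => A v hv /=.
  apply: sup_image_bounded; first by exists 0; exact: unit_ball0.
  by move=> a ha; apply: hC; exact: rnorm_tnth_cons.
- have [C hC] := IH (Num.max 1 M); exists C => A v hv /=.
  rewrite inf_imageE normrN; apply: sup_image_bounded.
    by exists 0; exact: unit_ball0.
  by move=> a ha; rewrite normrN; apply: hC; exact: rnorm_tnth_cons.
Qed.

Lemma rnormZ_real (R : realType) (A : cstarAlgType R) (r : R) (x : A) :
  rnorm (r%:C *: x) = `|r| * rnorm x.
Proof. by rewrite rnormZ normc_def/= expr0n addr0 sqrtr_sqr. Qed.

Lemma ulim_eq0 (R : realType) (I : Type) (U : set_system I)
    (UU : UltraFilter U) (F : I -> cstarAlgType R) (a : bfam F) :
  (forall e : R, 0 < e -> \forall i \near U, rnorm (a i) <= e) ->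
  ulim (U := U) a = 0.
Proof.
move=> ha; apply/eqP; rewrite eq_le ulim_ge0 andbT.
apply/ler_addgt0Pl => e e0; rewrite addr0; apply: ulim_near_le; exact: ha.
Qed.

(** Radial projection onto the unit ball changes a representative by
    [max 0 (rnorm (a i) - 1)], which vanishes in the limit. *)
Lemma unit_ball_lift (R : realType) (I : Type) (U : set_system I)
    (UU : UltraFilter U) (F : I -> cstarAlgType R) (x : ultraproduct UU F) :
  unit_ball x ->
  exists2 b : bfam F, (forall i, unit_ball (b i)) & uclass UU b = x.
Proof.
have [a <-] := uclass_surj x; rewrite unit_ballE rnorm_uclass => ha.
pose s i := if rnorm (a i) <= 1 then a i else ((rnorm (a i))^-1)%:C *: a i.
have s1 i : rnorm (s i) <= 1.
  rewrite /s; case: (leP (rnorm (a i)) 1) => // a1; rewrite rnormZ_real ger0_norm.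
    by rewrite mulVf// gt_eqF// (lt_trans ltr01).
  by rewrite invr_ge0 rnorm_ge0.
have sb : exists M : R, forall i, rnorm (s i) <= M by exists 1.
exists (BFam sb) => [i|]; first by rewrite unit_ballE; exact: s1.
apply/uclassP; apply: ulim_eq0 => e e0.
have : ulim (U := U) a < 1 + e by lra.
move=> /ulim_lt_near; apply: (@filterS _ U) => i ai.
have -> : (BFam sb - a) i = s i - a i by [].
rewrite /s; case: (leP (rnorm (a i)) 1) => [_|a1]; first by rewrite subrr rnorm0 ltW.
have n0 : rnorm (a i) != 0 by rewrite gt_eqF// (lt_trans ltr01).
have -> : ((rnorm (a i))^-1)%:C *: a i - a i = ((rnorm (a i))^-1 - 1)%:C *: a i.
  by rewrite rmorphB/= scalerBl scale1r.
rewrite rnormZ_real -[X in _ * X]ger0_norm ?rnorm_ge0// -normrM mulrBl mul1r.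
rewrite mulVf// distrC ger0_norm; lra.
Qed.

(** The quantifier step of the theorem of Los. The limit of the suprema is at least
    the supremum because elements of the ball of the ultraproduct lift to families
    in the balls; it is at most the supremum because a choice of almost optimal
    points at every index defines an element of the ultraproduct. *)
Lemma cvg_sup_unit_ball (R : realType) (I : Type) (U : set_system I)
    (UU : UltraFilter U) (F : I -> cstarAlgType R) (g : forall i, F i -> R)
    (h : ultraproduct UU F -> R) (C : R) :
  (forall i a, unit_ball a -> `|g i a| <= C) ->
  (forall b : bfam F, (forall i, unit_ball (b i)) ->
    g i (b i) @[i --> U] --> h (uclass UU b)) ->
  sup [set g i a | a in @unit_ball R (F i)] @[i --> U] -->
  sup [set h x | x in @unit_ball R (ultraproduct UU F)].
Proof.
move=> gC gh; set s := sup _.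
have g_ub i : has_ubound [set g i a | a in @unit_ball R (F i)].
  by exists C => _ [a ha <-]; exact: le_trans (ler_norm _) (gC _ _ ha).
have h_ub : has_ubound [set h x | x in @unit_ball R (ultraproduct UU F)].
  exists C => _ [x hx <-]; have [b hb <-] := unit_ball_lift hx.
  apply: (@cvgr_to_le _ U _ _ _ _ _ (gh b hb)); apply: nearW => i.
  exact: le_trans (ler_norm _) (gC _ _ (hb i)).
have ne (A : cstarAlgType R) (f : A -> R) : [set f a | a in @unit_ball R A] !=set0.
  by exists (f 0), 0 => //; exact: unit_ball0.
apply/cvgrPdist_le => e e0; have e2 : 0 < e / 2 by rewrite divr_gt0.
have [_ [x hx <-] xs] := sup_adherent e2 (conj (ne _ h) h_ub).
have [b hb bx] := unit_ball_lift hx.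
have c_ex i : exists a : F i, unit_ball a /\
    sup [set g i a | a in @unit_ball R (F i)] - e / 2 < g i a.
  have [_ [a ha <-] ga] := sup_adherent e2 (conj (ne _ (g i)) (g_ub i)).
  by exists a.
pose c i := projT1 (cid (c_ex i)).
have [c_ball c_sup] : (forall i, unit_ball (c i)) /\ (forall i,
    sup [set g i a | a in @unit_ball R (F i)] - e / 2 < g i (c i)).
  by split=> i; have [] := projT2 (cid (c_ex i)).
have cb : exists M : R, forall i, rnorm (c i) <= M.
  by exists 1 => i; rewrite -unit_ballE.
have cs : h (uclass UU (BFam cb)) <= s.
  apply: ub_le_sup => //; exists (uclass UU (BFam cb)) => //.
  rewrite unit_ballE rnorm_uclass; apply: ulim_near_le; apply: nearW => i.
  by rewrite -unit_ballE; exact: c_ball.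
have /cvgrPdist_lt/(_ _ e2) near_b := gh b hb.
have /cvgrPdist_lt/(_ _ e2) near_c := gh (BFam cb) c_ball.
move: near_b near_c; apply: (@filterS2 _ U) => i /=.
rewrite bx !ltr_norml ler_norml => /andP[_ b2] /andP[c1 _].
have := c_sup i.
have : g i (b i) <= sup [set g i a | a in @unit_ball R (F i)].
  by apply: ub_le_sup => //; exists (b i).
move: xs; rewrite -/s; lra.
Qed.

(** * The theorem of Los *)

Definition fiber (R : realType) (I : Type) (F : I -> cstarAlgType R) k
  (a : k.-tuple (bfam F)) (i : I) : k.-tuple (F i) :=
  [tuple of map (fun b : bfam F => b i) a].

Definition uclass_tuple (R : realType) (I : Type) (U : set_system I)
  (UU : UltraFilter U) (F : I -> cstarAlgType R) k (a : k.-tuple (bfam F)) :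
  k.-tuple (ultraproduct UU F) := [tuple of map (@uclass R I U UU F) a].

Lemma ultraproduct_unit (R : realType) (I : Type) (U : set_system I)
    (UU : UltraFilter U) (F : I -> cstarAlgType R) (e : bfam F) :
  (forall i, is_unit (e i)) -> is_unit (uclass UU e).
Proof.
move=> he x; have [a <-] := uclass_surj x.
have mulE (b c : bfam F) : uclass UU b ** uclass UU c = uclass UU (bfamM b c).
  exact: umulE.
split; rewrite mulE; congr uclass; apply: bfamP => i; [exact: (he i _).1|].
exact: (he i _).2.
Qed.

(** In a fibre without a unit the constant [I] has the junk value 0, so it commutes
    with classes when the fibres are unital. *)
Lemma eval_term_ultraproduct (R : realType) (I : Type) (U : set_system I)
    (UU : UltraFilter U) (F : I -> cstarAlgType R) k (t : term R k)
    (a : k.-tuple (bfam F)) :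
  (term_unit_free t \/ forall i, unital (F i)) ->
  exists2 b : bfam F, (forall i, b i = eval_term t (fiber a i)) &
    uclass UU b = eval_term t (uclass_tuple UU a).
Proof.
elim: t => [j|||t1 IH1 t2 IH2|c t1 IH1|t1 IH1 t2 IH2|t1 IH1] /= ht.
- by exists (tnth a j) => [i|]; rewrite tnth_map.
- by exists 0 => //; exact: uclass0.
- case: ht => // hu; have hb : exists M : R, forall i, rnorm (cunit (F i)) <= M.
    by exists 1 => i; exact: rnorm_cunit.
  exists (BFam hb) => //; apply/esym/cunitP/ultraproduct_unit => i /=.
  by have [e he] := hu i; rewrite (cunitP he).
- have [|b1 e1 <-] := IH1; first by case: ht => [/andP[]|]; [left|right].
  have [|b2 e2 <-] := IH2; first by case: ht => [/andP[]|]; [left|right].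
  by exists (b1 + b2) => [i|]; rewrite -?e1 -?e2// uclassD.
- have [//|b1 e1 <-] := IH1.
  by exists (c *: b1) => [i|]; rewrite -?e1// uclassZ.
- have [|b1 e1 <-] := IH1; first by case: ht => [/andP[]|]; [left|right].
  have [|b2 e2 <-] := IH2; first by case: ht => [/andP[]|]; [left|right].
  by exists (bfamM b1 b2) => [i|]; rewrite -?e1 -?e2//; exact/esym/umulE.
- have [//|b1 e1 <-] := IH1.
  by exists (bfam_star b1) => [i|]; rewrite -?e1//; exact/esym/ustarE.
Qed.

Lemma cvg_row (R : realType) (I : Type) (U : set_system I) (FU : Filter U) n
    (f : 'I_n -> I -> R) (l : 'I_n -> R) :
  (forall j, f j i @[i --> U] --> l j) ->
  (\row_j f j i) @[i --> U] --> \row_j l j.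
Proof.
move=> fl; apply/cvg_ballP => e e0.
have near_all : \forall i \near U, forall j, ball (l j) e (f j i).
  by apply: filter_forall => j; have /cvg_ballP/(_ _ e0) := fl j.
by apply: filterS near_all => i hi; split=> // r j; rewrite !mxE.
Qed.

Lemma uniform_bound (R : realType) (I : Type) (F : I -> cstarAlgType R) k
    (a : k.-tuple (bfam F)) :
  exists M : R, forall i j, rnorm (tnth (fiber a i) j) <= M.
Proof.
have /choice[M hM] := fun j => bfam_bnd (tnth a j).
exists (\sum_j `|M j|) => i j; rewrite tnth_map (le_trans (hM j i))//.
rewrite (le_trans (ler_norm _))// (bigD1 j)//= ler_wpDr// sumr_ge0//.
Qed.

Theorem los (R : realType) (I : Type) (U : set_system I)
    (UU : UltraFilter U) (F : I -> cstarAlgType R) k (phi : formula R k)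
    (a : k.-tuple (bfam F)) :
  (unit_free phi \/ forall i, unital (F i)) ->
  eval_formula phi (fiber a i) @[i --> U] -->
    eval_formula phi (uclass_tuple UU a).
Proof.
(* both quantifiers at once: [s] is the identity for suprema, and the negation for
   infima, which are opposites of suprema of opposites *)
have quantifier m (psi : formula R m.+1)
    (IH : forall a' : m.+1.-tuple (bfam F),
      (unit_free psi \/ forall i, unital (F i)) ->
      eval_formula psi (fiber a' i) @[i --> U] -->
        eval_formula psi (uclass_tuple UU a'))
    (b : m.-tuple (bfam F)) (s : R -> R) :
    (unit_free psi \/ forall i, unital (F i)) ->
    continuous s -> (forall x, `|s x| = `|x|) ->
    sup [set s (eval_formula psi [tuple of x :: fiber b i])
      | x in @unit_ball R (F i)] @[i --> U] -->
    sup [set s (eval_formula psi [tuple of x :: uclass_tuple UU b])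
      | x in @unit_ball R (ultraproduct UU F)].
  move=> hpsi cs s_norm; have [M hM] := uniform_bound b.
  have [C hC] := eval_formula_bounded psi (Num.max 1 M).
  apply: (@cvg_sup_unit_ball _ _ _ UU _
    (fun i x => s (eval_formula psi [tuple of x :: fiber b i]))
    (fun x => s (eval_formula psi [tuple of x :: uclass_tuple UU b])) C).
    move=> i x hx; rewrite s_norm; apply: hC.
    by apply: rnorm_tnth_cons => // j; exact: hM.
  move=> c _; apply: (@cvg_comp _ _ _
    (fun i => eval_formula psi [tuple of c i :: fiber b i]) s); last exact: cs.
  have := IH [tuple of c :: b] hpsi.
  rewrite (_ : uclass_tuple UU _ =
    [tuple of uclass UU c :: uclass_tuple UU b]); last exact: val_inj.
  rewrite (_ : (fun i => _) =
    fun i => eval_formula psi [tuple of c i :: fiber b i])//.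
  by apply/funext => i; congr eval_formula; apply: val_inj.
elim: phi a => [{}k t|{}k n f cf args IH|{}k psi IH|{}k psi IH] a hphi /=.
- have [b be <-] := eval_term_ultraproduct UU a hphi.
  rewrite rnorm_uclass; under eq_fun do rewrite -be; exact: ulim_cvg.
- apply: (@cvg_comp _ _ _ (fun i => \row_j eval_formula (args j) (fiber a i)) f);
    last exact: cf.
  apply: cvg_row => j; apply: IH.
  by case: hphi => [/forallP/(_ j)|]; [left|right].
- exact: (quantifier k psi IH a id hphi (fun=> cvg_id) (fun=> erefl)).
- under eq_fun do rewrite inf_imageE; rewrite inf_imageE; apply: cvgN.
  have opp_cont : continuous (-%R : R -> R) by move=> x; exact: opp_continuous.
  exact: (quantifier k psi IH a -%R hphi opp_cont (fun=> normrN _)).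
Qed.

(** * Realizing the type of an element in another ultraproduct *)

Lemma dist_continuous (R : realType) (V : normedModType R) (r : V) :
  continuous (fun w : V => `|w - r|).
Proof.
by move=> w; apply: cvg_norm; apply: cvgB; [exact: cvg_id|exact: cvg_cst].
Qed.

(** Finitely many values of formulae at [p] are approximated at a single element of
    some fibre: the sentence [inf_x] of the distance between the two vectors of
    values vanishes in [A], hence its values in the fibres tend to 0. *)
Lemma approximate_realization (R : realType) (A : cstarAlgType R) (I : Type)
    (U : set_system I) (UU : UltraFilter U) (F : I -> cstarAlgType R) (p : A)
    n (psi : 'I_n -> formula R 1) (e : R) :
  elementarily_equivalent A (ultraproduct UU F) -> unit_ball p ->
  (forall j, unit_free (psi j)) -> 0 < e ->
  exists i, exists2 x : F i, unit_ball x & forall j,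
    `|eval_formula (psi j) [tuple p] - eval_formula (psi j) [tuple x]| < e.
Proof.
move=> AU p1 psi_uf e0; pose r := \row_j eval_formula (psi j) [tuple p].
pose dist (w : 'rV[R]_n) : R := `|w - r|.
have dist_cont : continuous dist.
  exact: dist_continuous.
pose theta : sentence R := finf (fapp dist_cont psi).
have theta_uf : unit_free theta by apply/forallP.
have thetaA : sentence_value A theta = 0.
  have vals_ge0 : lbound
      [set dist (\row_j eval_formula (psi j) [tuple of a :: [tuple]])
        | a in @unit_ball R A] 0.
    by move=> _ [a _ <-]; exact: normr_ge0.
  rewrite /sentence_value /=; apply/eqP; rewrite eq_le; apply/andP; split.
    apply: ge_inf; first by exists 0.
    exists p => //; rewrite /dist; apply/eqP; rewrite normr_eq0 subr_eq0.
    apply/eqP/rowP => j; rewrite !mxE; congr eval_formula; exact: val_inj.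
  apply: lb_le_inf => //.
  by exists (dist (\row_j eval_formula (psi j) [tuple of p :: [tuple]])), p.
have theta_cvg := @los R I U UU F _ theta [tuple] (or_introl theta_uf).
rewrite (_ : eval_formula _ _ = 0) in theta_cvg; last first.
  rewrite -thetaA (AU theta (or_introl theta_uf)) /sentence_value.
  by congr eval_formula; exact: val_inj.
have /cvgrPdist_lt/(_ _ e0) near0 := theta_cvg.
have [i hi] := filter_ex near0; rewrite sub0r normrN in hi; exists i.
have [|_ [x hx <-] dx] := inf_lt _ (le_lt_trans (ler_norm _) hi).
  by eexists; exists 0; [exact: unit_ball0|reflexivity].
exists x => // j.
have : ball (\row_j eval_formula (psi j) [tuple of x :: fiber [tuple] i]) e r.
  by rewrite mx_norm_ball.
move=> [_ /(_ ord0 j)]; rewrite !mxE -ball_normE /= distrC.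
by rewrite (_ : [tuple of _] = [tuple x]) //; exact: val_inj.
Qed.

(** The new index set consists of the finite sets of formulae paired with an error
    exponent; any ultrafilter containing its cones turns the approximate
    realizations into an exact one. *)
Lemma type_realization (R : realType) (A : cstarAlgType R) (I : Type)
    (U : set_system I) (UU : UltraFilter U) (F : I -> cstarAlgType R) (p : A) :
  elementarily_equivalent A (ultraproduct UU F) -> unit_ball p ->
  exists (J : Type) (V : set_system J) (VV : UltraFilter V) (iota : J -> I)
      (x : ultraproduct VV (fun j => F (iota j))),
    forall psi : formula R 1, unit_free psi ->
      eval_formula psi [tuple p] = eval_formula psi [tuple x].
Proof.
move=> AU p1; pose Psi := {psi : formula R 1 | unit_free psi}.
pose J : Type := (seq {classic Psi} * nat)%type.
pose ev (B : cstarAlgType R) (y : B) (psi : {classic Psi}) :=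
  eval_formula (sval (psi : Psi)) [tuple y].
have x_ex (j : J) : exists ix : {i : I & F i}, unit_ball (projT2 ix) /\
    forall psi, psi \in j.1 -> `|ev A p psi - ev _ (projT2 ix) psi| < 2^-1 ^+ j.2.
  have e0 : 0 < (2^-1 : R) ^+ j.2 by rewrite exprn_gt0// invr_gt0.
  have [|i [x hx xp]] := approximate_realization AU p1
    (psi := fun k => sval (tnth (in_tuple j.1) k : Psi)) _ e0.
    by move=> k; exact: (svalP (tnth (in_tuple j.1) k : Psi)).
  exists (existT _ i x); split=> // psi /(tnthP (in_tuple j.1))[k ->].
  exact: xp.
have /choice[ix hix] := x_ex.
pose cone (j : J) : set J :=
  fun t : J => {subset j.1 <= t.1} /\ (j.2 <= t.2)%N.
have cone_filter : ProperFilter (filter_from setT cone).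
  apply: filter_from_proper => [|j _]; last by exists j; split.
  apply: filter_fromT_filter => [|j k]; first by exists ([::], 0%N).
  exists (j.1 ++ k.1, maxn j.2 k.2) => t [/= sub]; rewrite geq_max => /andP[jt kt].
  by split; split=> // psi hpsi; apply: sub; rewrite mem_cat hpsi ?orbT.
have [V [VV coneV]] := ultraFilterLemma cone_filter.
pose iota j := projT1 (ix j); pose xf j : F (iota j) := projT2 (ix j).
have xb : exists M : R, forall j, rnorm (xf j) <= M.
  by exists 1 => j; rewrite -unit_ballE; exact: (hix j).1.
pose X : bfam (fun j => F (iota j)) := BFam xb.
exists J, V, VV, iota, (uclass VV X) => psi psi_uf.
have := @los R J V VV _ _ psi [tuple X] (or_introl psi_uf).
rewrite (_ : uclass_tuple _ _ = [tuple uclass VV X]); last exact: val_inj.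
move=> /(cvg_lim (@Rhausdorff _)) <-; apply/esym/cvg_lim => //.
rewrite (_ : (fun j => _) = fun j => eval_formula psi [tuple xf j]); last first.
  by apply/funext => j; congr eval_formula; exact: val_inj.
apply/cvgrPdist_lt => e /half_small[N hN]; apply: coneV.
exists ([:: (exist _ psi psi_uf : Psi) : {classic Psi}], N) => // t [/= sub Nt].
have /(hix t).2 := sub (exist _ psi psi_uf : Psi) (mem_head _ _).
by move=> ht; apply: lt_trans (hN _ Nt).
Qed.

(** * Projections near almost projections *)

Lemma rnorm_eq0_of_half (R : realType) (A : cstarAlgType R) (x : A) (C : R) :
  0 < C -> (forall n, rnorm x <= C * 2^-1 ^+ n) -> x = 0.
Proof.
move=> C0 hx; apply: rnorm_eq0; apply/eqP; rewrite eq_le rnorm_ge0 andbT.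
apply/ler_addgt0Pl => e e0; rewrite addr0.
have [N /(_ N (leqnn _)) hN] := half_small (divr_gt0 e0 C0).
apply: le_trans (hx N) _; move: hN; rewrite ltr_pdivlMr// mulrC; exact: ltW.
Qed.

Definition defect (R : realType) (A : cstarAlgType R) (y : A) : A := y ** y - y.

(** With [d] the defect [y^2 - y], the correction is [(1 - 2y) d], written without
    a unit; [newton y] is then the polynomial [3y^2 - 2y^3], which fixes 0 and 1
    with derivative zero there. *)
Definition correction (R : realType) (A : cstarAlgType R) (y : A) : A :=
  defect y - (y ** defect y + y ** defect y).

Definition newton (R : realType) (A : cstarAlgType R) (y : A) : A :=
  y + correction y.

Lemma defectC (R : realType) (A : cstarAlgType R) (y : A) :
  defect y ** y = y ** defect y.
Proof. by rewrite /defect cmulDl cmulDr cmulNr cmulrN cmulA. Qed.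

Lemma star_defect (R : realType) (A : cstarAlgType R) (y : A) :
  star y = y -> star (defect y) = defect y.
Proof. by move=> ys; rewrite /defect starD starN starM !ys. Qed.

Lemma star_newton (R : realType) (A : cstarAlgType R) (y : A) :
  star y = y -> star (newton y) = newton y.
Proof.
move=> ys; rewrite /newton /correction.
move: (star_defect ys) (defectC y); move: (defect y) => d ds dC.
by rewrite !(starD, starN, starM) ys ds dC.
Qed.

(** Quadratic convergence: the correction is a multiple of the defect, so that both
    terms have order two in it. *)
Lemma defect_newton (R : realType) (A : cstarAlgType R) (y : A) :
  defect (newton y) =
  correction y ** correction y - (defect y ** defect y) *+ 4.
Proof.
have yy : y ** y = y + defect y by rewrite /defect addrC subrK.
have dC := defectC y; have eE : correction y =
  defect y - (y ** defect y + y ** defect y) := erefl.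
rewrite {1}/defect /newton; move: (correction y) eE => e eE.
move: (defect y) yy dC eE => d yy dC eE.
have yz : y ** (y ** d) = y ** d + d ** d by rewrite cmulA yy cmulDl.
have ye : y ** e = - (y ** d + (d ** d + d ** d)).
  rewrite eE cmulDr cmulrN cmulDr yz; move: (y ** d) (d ** d) => z w.
  by rewrite -[z + w + _]addrA opprD addrA subrr add0r addrCA.
have ey : e ** y = y ** e.
  by rewrite eE !(cmulDl, cmulDr, cmulNr, cmulrN) -!cmulA dC.
have de : d - e = y ** d + y ** d by rewrite eE subKr.
rewrite cmulDl !cmulDr ey yy opprD.
(* group as [(y - y) + (d - e) + (ye + ye) + ee] *)
rewrite [LHS](AC ((2*1)*2*2) (((1*6)*(2*7))*(3*4)*5))/= subrr add0r de ye.
move: (y ** d) (d ** d) (e ** e) => z w u.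
rewrite [RHS]addrC; congr (_ + _).
rewrite -opprD [X in - X]addrACA opprD addrA subrr add0r.
by rewrite -[4%N]/(2 + 2)%N mulrnDr mulr2n.
Qed.

Lemma rnorm_almost_projection (R : realType) (A : cstarAlgType R) (y : A) :
  star y = y -> rnorm (defect y) <= 64^-1 -> rnorm y <= 2.
Proof.
move=> ys yd; have := rnorm_star_mul y; rewrite ys => yy.
have : rnorm (y ** y) <= rnorm y + rnorm (defect y).
  by rewrite -{1}[y ** y](subrK y) addrC rnormD.
by have := rnorm_ge0 y; rewrite yy; nra.
Qed.

Lemma rnorm_correction (R : realType) (A : cstarAlgType R) (y : A) :
  rnorm y <= 2 -> rnorm (correction y) <= 5 * rnorm (defect y).
Proof.
move=> y2; have yd : rnorm (y ** defect y) <= 2 * rnorm (defect y).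
  by apply: le_trans (rnormM _ _) _; rewrite ler_wpM2r ?rnorm_ge0.
apply: le_trans (rnormD _ _) _; rewrite rnormN.
by have := rnormD (y ** defect y) (y ** defect y); lra.
Qed.

(** By the previous bounds the new defect is at most [25 + 4 = 29] times the square
    of the old one, which is where the threshold [1 / 64] comes from. *)
Lemma rnorm_defect_newton (R : realType) (A : cstarAlgType R) (y : A) :
  star y = y -> rnorm (defect y) <= 64^-1 ->
  rnorm (defect (newton y)) <= rnorm (defect y) / 2.
Proof.
move=> ys yd; have ce := rnorm_correction (rnorm_almost_projection ys yd).
rewrite defect_newton; apply: le_trans (rnormD _ _) _; rewrite rnormN.
have cc := rnormM (correction y) (correction y).
have dd : rnorm ((defect y ** defect y) *+ 4) <= 4 * rnorm (defect y) ^+ 2.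
  have := rnormM (defect y) (defect y).
  rewrite -[4%N]/(2 + 2)%N mulrnDr mulr2n.
  set w := defect y ** defect y => hw.
  have := rnormD (w + w) (w + w); have := rnormD w w; lra.
have := rnorm_ge0 (defect y); have := rnorm_ge0 (correction y); nra.
Qed.

(** The Newton iterates form a sequence with geometrically small increments; the
    limit is self-adjoint and idempotent because the defects tend to 0. *)
Lemma projection_near (R : realType) (A : cstarAlgType R) (y : A) :
  star y = y -> rnorm (defect y) <= 64^-1 ->
  exists2 q : A, is_projection q & rnorm (q - y) <= 10 * rnorm (defect y).
Proof.
move=> ys yd; pose u n := iter n (@newton R A) y.
set D := rnorm (defect y) in yd *.
have D0 : 0 <= D := rnorm_ge0 _.
have p0 n : 0 < (2^-1 : R) ^+ n by rewrite exprn_gt0// invr_gt0.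
have p1 n : (2^-1 : R) ^+ n <= 1.
  by rewrite exprn_ile1// ?invr_ge0// invf_le1// ler1n.
have us n : star (u n) = u n by elim: n => //= n; exact: star_newton.
have ud n : rnorm (defect (u n)) <= D * 2^-1 ^+ n.
  elim: n => [|n IH]; first by rewrite expr0 mulr1.
  apply: le_trans (rnorm_defect_newton (us n) _) _.
    by apply: le_trans IH _; have := p1 n; have := p0 n; nra.
  by rewrite exprSr mulrA ler_wpM2r// invr_ge0.
have u2 n : rnorm (u n) <= 2.
  apply: rnorm_almost_projection (us n) _; apply: le_trans (ud n) _.
  by have := p1 n; have := p0 n; nra.
have du n : rnorm (u n.+1 - u n) <= 5 * D * 2^-1 ^+ n.
  rewrite /= /newton addrAC subrr add0r.
  by apply: le_trans (rnorm_correction (u2 n)) _; have := ud n; lra.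
have uy n : rnorm (u n - y) <= 10 * D * (1 - 2^-1 ^+ n).
  elim: n => [|n IH]; first by rewrite subrr rnorm0 expr0 subrr mulr0.
  apply: le_trans (rnorm_distD (u n) _ _) _; have := du n.
  by rewrite exprSr; move: IH (p0 n); nra.
have [|l lu] := complete_seq (u := u).
  by move=> n; apply: le_trans (du n) _; have := p0 n; nra.
have l0 := rnorm_ge0 l.
exists l; first split.
- apply/eqP; rewrite -subr_eq0; apply/eqP.
  apply: (rnorm_eq0_of_half (C := 4)) => // n.
  apply: le_trans (rnorm_distD (u n) _ _) _.
  have -> : u n - star l = star (u n - l) by rewrite starD starN us.
  by rewrite rnorm_star rnorm_distC; have := lu n; rewrite rnorm_distC; lra.
- apply/eqP; rewrite -subr_eq0; apply/eqP.
  apply: (rnorm_eq0_of_half (C := 2 * rnorm l + 6 + D)); first lra.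
  move=> n; rewrite rnorm_distC.
  have -> : l ** l - l = l ** (l - u n) + (l - u n) ** u n +
      (defect (u n) + (u n - l)).
    rewrite /defect cmulDr cmulDl cmulrN cmulNr.
    by rewrite !addrA !subrK.
  apply: le_trans (rnormD _ _) _.
  have h1 := rnormD (l ** (l - u n)) ((l - u n) ** u n).
  have h2 := rnormD (defect (u n)) (u n - l).
  have h3 := rnormM l (l - u n); have h4 := rnormM (l - u n) (u n).
  have h5 := lu n; rewrite [rnorm (u n - l)]rnorm_distC in h2.
  have h6 := ud n; have h7 := u2 n.
  have h8 := rnorm_ge0 (l - u n); have h9 := p0 n; have h10 := rnorm_ge0 (u n).
  have h11 : rnorm l * rnorm (l - u n) <= rnorm l * (2 * 2^-1 ^+ n).
    by rewrite ler_wpM2l.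
  have h12 : rnorm (l - u n) * rnorm (u n) <= 2 * 2^-1 ^+ n * 2.
    by apply: ler_pM.
  nra.
- apply/ler_addgt0Pl => e e0.
  have [N /(_ N (leqnn _)) hN] := half_small (divr_gt0 e0 (ltr0n R 2)).
  apply: le_trans (rnorm_distD (u N) _ _) _.
  by have := lu N; have := uy N; have := p0 N; nra.
Qed.

(** * Lifting projections, and the corner theorem *)

Lemma projection0 (R : realType) (A : cstarAlgType R) : is_projection (0 : A).
Proof. by split; rewrite ?star0 ?cmul0r. Qed.

Lemma scale_half_double (K : numFieldType) (V : lmodType K) (x : V) :
  2^-1 *: (x + x) = x.
Proof. by rewrite -mulr2n -(scaler_nat 2 x) scalerA mulVf ?scale1r// pnatr_eq0. Qed.

(** A representative of [p] may be replaced by its self-adjoint part; its defect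
    then tends to 0 along [U], so at almost all indices there is a projection nearby.
    At the remaining indices any projection will do. *)
Lemma projection_lift (R : realType) (I : Type) (U : set_system I)
    (UU : UltraFilter U) (F : I -> cstarAlgType R) (p : ultraproduct UU F) :
  is_projection p ->
  exists2 q : bfam F, (forall i, is_projection (q i)) & uclass UU q = p.
Proof.
have [a <-] := uclass_surj p => -[ps pp].
pose y : bfam F := 2^-1 *: (a + bfam_star a).
have ys i : star (y i) = y i.
  have -> : y i = 2^-1 *: (a i + star (a i)) by [].
  rewrite starZ starD starK addrC; congr (_ *: _).
  by rewrite fmorphV rmorph_nat.
have yp : uclass UU y = uclass UU a.
  rewrite uclassZ uclassD (_ : uclass UU (bfam_star a) = uclass UU a).
    by rewrite scale_half_double.
  by rewrite ps; exact/esym/ustarE.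
have d0 : ulim (U := U) (bfamM y y - y) = 0.
  apply/(uclassP UU).
  rewrite (_ : uclass UU (bfamM y y) = uclass UU y ** uclass UU y);
    last exact/esym/umulE.
  by rewrite yp -pp.
have q_ex i : exists q : F i, is_projection q /\
    (rnorm (defect (y i)) <= 64^-1 ->
     rnorm (q - y i) <= 10 * rnorm (defect (y i))).
  have [yd|_] := leP (rnorm (defect (y i))) 64^-1.
    by have [q hq qy] := projection_near (ys i) yd; exists q.
  by exists 0; split=> //; exact: projection0.
pose q i := projT1 (cid (q_ex i)).
have hq i : is_projection (q i) by case: (projT2 (cid (q_ex i))).
have qy i : rnorm (defect (y i)) <= 64^-1 ->
    rnorm (q i - y i) <= 10 * rnorm (defect (y i)).
  by case: (projT2 (cid (q_ex i))).
have qb : exists M : R, forall i, rnorm (q i) <= M.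
  by exists 1 => i; exact: rnorm_projection.
exists (BFam qb) => //; rewrite -yp; apply/uclassP.
apply: ulim_eq0 => e e0.
have : ulim (U := U) (bfamM y y - y) < Num.min 64^-1 (e / 10).
  by rewrite d0 lt_min invr_gt0 ltr0n divr_gt0.
move=> /ulim_lt_near; apply: (@filterS _ U) => i; rewrite lt_min.
have -> : (bfamM y y - y) i = defect (y i) by [].
move=> /andP[d1 d2]; apply: le_trans (qy i (ltW d1)) _; lra.
Qed.

Lemma compressD (R : realType) (A : cstarAlgType R) (q : A)
  (hq : is_projection q) : {morph compress hq : x y / x + y}.
Proof. by move=> x y; apply: val_inj; rewrite /= cmulDr cmulDl. Qed.

Lemma compressZ (R : realType) (A : cstarAlgType R) (q : A)
  (hq : is_projection q) (c : R[i]) (x : A) :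
  compress hq (c *: x) = c *: compress hq x.
Proof. by apply: val_inj; rewrite /= cscalerAl cscalerAr. Qed.

Lemma corner_finite_dimensional (R : realType) (A : cstarAlgType R) (q : A)
  (hq : is_projection q) : finite_dimensional A -> finite_dimensional (corner hq).
Proof.
move=> [n [b hb]]; exists n, (fun j => compress hq (b j)) => x.
have [c hc] := hb (val x); exists c; rewrite -[LHS]compressK hc.
have compress0 : compress hq 0 = 0 by apply: val_inj; rewrite /= cmulr0 cmul0r.
rewrite (big_morph _ (compressD hq) compress0).
by apply: eq_bigr => j _; exact: compressZ.
Qed.

Lemma corner_sentence (R : realType) (A : cstarAlgType R) (q : A)
    (hq : is_projection q) (phi : sentence R) :
  sentence_value (corner hq) phi = eval_formula (relativize phi) [tuple q].
Proof.
rewrite (_ : [tuple q] = [tuple of rcons [tuple] q]); last exact: val_inj.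
by rewrite -eval_relativize; congr eval_formula; exact: val_inj.
Qed.

(** Being a projection is part of the type of an element. *)
Lemma projection_transfer (R : realType) (A B : cstarAlgType R) (p : A) (q : B) :
  (forall psi : formula R 1, unit_free psi ->
    eval_formula psi [tuple p] = eval_formula psi [tuple q]) ->
  is_projection p -> is_projection q.
Proof.
move=> pq [ps pp]; pose x : term R 1 := tvar R ord0.
have x_val (C : cstarAlgType R) (c : C) : tnth [tuple c] ord0 = c by [].
have transfer (t : term R 1) : term_unit_free t ->
    eval_term t [tuple p] = p -> eval_term t [tuple q] = q.
  move=> t_uf tp; have := pq (fnorm (tadd t (tscale (-1) x))).
  rewrite /= t_uf tp !x_val !scaleN1r subrr rnorm0 => /(_ isT)/esym/rnorm_eq0.
  by move=> /eqP; rewrite subr_eq0 => /eqP.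
split; apply/esym.
  by apply: (transfer (tstar x)) => //; rewrite /= x_val -ps.
by apply: (transfer (tmul x x)) => //; rewrite /= x_val -pp.
Qed.

Theorem proposition5p2 (R : realType) (A : cstarAlgType R) (p : A)
    (hp : is_projection p) :
  pseudocompact A -> pseudocompact (corner hp).
Proof.
move=> [I [U [UU [F [F_fd AU]]]]].
have p1 : unit_ball p by rewrite unit_ballE; exact: rnorm_projection.
have [J [V [VV [iota [P Pp]]]]] := type_realization AU p1.
have [q hq qP] := projection_lift (projection_transfer Pp hp).
pose G j := corner (hq j) : cstarAlgType R.
exists J, V, VV, G; split=> [j|phi _].
  exact: corner_finite_dimensional.
have G_unital j : unital (G j).
  by exists (compress (hq j) (q j)); exact: corner_is_unit.
have lim_q := @los R J V VV _ _ (relativize phi) [tuple q]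
  (or_introl (relativize_unit_free phi)).
have lim_G := @los R J V VV G _ phi [tuple] (or_intror G_unital).
rewrite corner_sentence Pp ?relativize_unit_free//.
transitivity (lim ((fun j => sentence_value (G j) phi) @ V)).
  apply/esym/cvg_lim => //; move: lim_q.
  rewrite (_ : uclass_tuple _ _ = [tuple P]); last by apply: val_inj; rewrite /= qP.
  rewrite (_ : (fun j => _) = fun j => sentence_value (G j) phi)//.
  apply/funext => j; rewrite corner_sentence.
  by congr eval_formula; exact: val_inj.
apply: cvg_lim => //; move: lim_G.
rewrite (_ : uclass_tuple _ _ = [tuple]); last exact: val_inj.
rewrite (_ : (fun j => _) = fun j => sentence_value (G j) phi)//.
by apply/funext => j; congr eval_formula; exact: val_inj.
Qed.
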